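(* There exists a continuum $X$ such that $E^{CC}_X \sim_B (\mathbb{R}/\ell_\infty)^{\mathbb{N}}$.
   Context: A continuum is a nonempty compact connected metrizable space (single points are continua). For a metric space $X$, the chain continuum-connection relation $E_X^{CC}$ on $X$ is: $x\,E_X^{CC}\,y$ iff for every $\varepsilon>0$ there are $n\in\mathbb{N}$ and continua $K_0,\dots,K_n\subset X$ of diameter $<\varepsilon$ such that $x\in K_0$, $y\in K_n$ and $K_i\cap K_{i+1}\neq\emptyset$ for $0\le i<n$; on a compact space this does not depend on the choice of compatible metric. $\mathbb{R}/\ell_\infty$ denotes the equivalence relation on $\mathbb{R}^{\mathbb{N}}$ in which $x,y$ are related iff $x-y\in\ell_\infty$ (i.e. $x-y$ is bounded). For an equivalence relation $F$ on $Y$, $F^{\mathbb{N}}$ is the equivalence relation on $Y^{\mathbb{N}}$ in which $(x_n)$ and $(y_n)$ are related iff $x_nFy_n$ for all $n$. For equivalence relations $E,F$ on standard Borel spaces $X,Y$, $E\leq_B F$ means that there is a Borel map $f:X\to Y$ with $xEy\iff f(x)Ff(y)$ for all $x,y\in X$, and $E\sim_B F$ means $E\leq_B F$ and $F\leq_B E$. *)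

(* Defs.v *)
From HB Require Import structures.
From mathcomp Require Import all_boot all_order all_algebra.
From mathcomp Require Import all_classical all_reals all_analysis.

Set Implicit Arguments.
Unset Strict Implicit.
Unset Printing Implicit Defensive.

Import Order.TTheory GRing.Theory Num.Theory.
Import numFieldNormedType.Exports.

Local Open Scope classical_set_scope.
Local Open Scope ring_scope.

(* Subsets of a metric space are metrizable, so metrizability is imposed on the
   ambient type only. *)
Definition continuum (T : topologicalType) (K : set T) : Prop :=
  [/\ K !=set0, compact K & connected K].

Definition diameter (R : realType) (X : metricType R) (K : set X) : \bar R :=
  ereal_sup [set (mdist p.1 p.2)%:E | p in K `*` K].

(* Only the values K 0, ..., K n matter. *)
Definition chain_continuum_connected (R : realType) (X : metricType R)
    (x y : X) : Prop :=
  forall eps : R, 0 < eps ->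
  exists (n : nat) (K : nat -> set X),
    [/\ forall i, (i <= n)%N -> continuum (K i) /\ (diameter (K i) < eps%:E)%E,
        K 0%N x,
        K n y &
        forall i, (i < n)%N -> K i `&` K i.+1 !=set0].

(* [bounded_fun] is boundedness of the sequence, i.e. x - y in ell_infty. *)
Definition eq_mod_linfty (R : realType) (x y : nat -> R) : Prop :=
  bounded_fun (fun n : nat => x n - y n).

Definition rel_power (Y : Type) (F : Y -> Y -> Prop) (x y : nat -> Y) : Prop :=
  forall n, F (x n) (y n).

(* [g_sigma_algebraType] needs a pointed carrier, so the generated
   sigma-algebras are compared directly. *)
Definition borel_fun (X Y : topologicalType) (f : X -> Y) : Prop :=
  forall B : set Y, <<s @open Y >> B -> <<s @open X >> (f @^-1` B).

(* Meaningful for Polish X and Y, whose Borel sigma-algebras are standard. *)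
Definition borel_reducible (X Y : topologicalType)
    (E : X -> X -> Prop) (F : Y -> Y -> Prop) : Prop :=
  exists f : X -> Y, borel_fun f /\ forall x y, E x y <-> F (f x) (f y).

Definition borel_bireducible (X Y : topologicalType)
    (E : X -> X -> Prop) (F : Y -> Y -> Prop) : Prop :=
  borel_reducible E F /\ borel_reducible F E.

(* R^N and (R^N)^N with the (iterated) product topology. *)
Definition real_seq (R : realType) : topologicalType :=
  prod_topology (fun _ : nat => R).

Definition real_seq_seq (R : realType) : topologicalType :=
  prod_topology (fun _ : nat => real_seq R).

(* Main.v *)
(* Let tent be the distance to the set of even integers.  The continuum consists
   of the arrays z of reals with 0 <= z i n <= 4 n + 1 and tent (z i n) = z i 0,
   in the product topology.  Within one block i, all coordinates fold onto the
   single driving value z i 0 in [0, 1].  On a continuum of small diameter the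
   driving value cannot reach both 0 and 1, so no coordinate of the block crosses
   an interval of length > 2: chains of small continua displace each block
   boundedly.  Conversely, a uniformly bounded displacement is a finite
   succession of straight segments issuing from even integer points, and blocks
   of large index lie in one small continuum because the whole space is
   connected.  Hence u and v are chain continuum-connected iff u i - v i is
   bounded for every i.  So inclusion reduces the relation to
   (R/l_infty)^N, and truncated integer parts of the shifted coordinates,
   each coordinate being repeated with ever larger bounds, reduce it back. *)

Require Import Defs.
From HB Require Import structures.
From mathcomp Require Import all_boot all_order all_algebra.
From mathcomp Require Import all_classical all_reals all_analysis.
From mathcomp Require Import ring lra zify.

Set Implicit Arguments.
Unset Strict Implicit.
Unset Printing Implicit Defensive.

Import Order.TTheory GRing.Theory Num.Theory.
Import numFieldNormedType.Exports.

Local Open Scope classical_set_scope.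
Local Open Scope ring_scope.

(** * The tent map: distance to the even integers *)

Definition tent (R : realType) (s : R) : R :=
  `|s - 2 * (Num.floor ((s + 1) / 2))%:~R|.

Section Tent.
Context {R : realType}.
Implicit Types (s t : R) (k : int).

Let tent_itv s : -1 <= s - 2 * (Num.floor ((s + 1) / 2))%:~R < 1.
Proof.
have := floor_itv ((s + 1) / 2); rewrite intrD1.
by move=> /andP[? ?]; apply/andP; split; lra.
Qed.

Lemma tent_le s k : tent s <= `|s - 2 * k%:~R|.
Proof.
rewrite /tent; set f := Num.floor _; have /andP[h1 h2] := tent_itv s.
rewrite -/f in h1 h2.
have [fk|kf|->] := ltrgtP f k; last by [].
- have : (f + 1)%:~R <= k%:~R :> R by rewrite ler_int lezD1.
  rewrite intrD1 => h; rewrite [leRHS]ler0_norm; last by lra.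
  by rewrite ler_norml; apply/andP; split; lra.
- have : (k + 1)%:~R <= f%:~R :> R by rewrite ler_int lezD1.
  rewrite intrD1 => h; rewrite [leRHS]ger0_norm; last by lra.
  by rewrite ler_norml; apply/andP; split; lra.
Qed.

(** Distinct even integers are at least 2 apart, so one within distance 1 is nearest; at an odd
    integer both neighbours give the value 1. *)
Lemma tent_eq s k : `|s - 2 * k%:~R| <= 1 -> tent s = `|s - 2 * k%:~R|.
Proof.
move=> sk; apply/eqP; rewrite eq_le tent_le /=.
rewrite /tent; set f := Num.floor _; have /andP[h1 h2] := tent_itv s.
rewrite -/f in h1 h2; move: (sk); rewrite ler_norml => /andP[h3 h4].
have [fk|kf|->] := ltrgtP f k; last by [].
- have : (f + 1)%:~R <= k%:~R :> R by rewrite ler_int lezD1.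
  rewrite intrD1 => h; rewrite [leRHS]ger0_norm; last by lra.
  by rewrite ler_norml; apply/andP; split; lra.
- have : (k + 1)%:~R <= f%:~R :> R by rewrite ler_int lezD1.
  rewrite intrD1 => h; rewrite [leRHS]ler0_norm; last by lra.
  by rewrite ler_norml; apply/andP; split; lra.
Qed.

(** The even integer nearest to [t] is a competitor for [s]. *)
Lemma tent_lip s t : `|tent s - tent t| <= `|s - t|.
Proof.
wlog : s t / tent t <= tent s.
  move=> h; have [/h //|/ltW/h] := leP (tent t) (tent s).
  by rewrite distrC (distrC t).
move=> ts; rewrite ger0_norm ?subr_ge0// lerBlDr.
apply: (le_trans (tent_le s (Num.floor ((t + 1) / 2)))).
by rewrite /tent (le_trans _ (ler_normD _ _))// addrA subrK.
Qed.

Lemma tent_continuous : continuous (@tent R).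
Proof.
move=> s; apply/cvgrPdist_le => e e0; near=> t.
apply: (le_trans (tent_lip s t)); near: t.
exact: cvgr_dist_le.
Unshelve. all: by end_near. Qed.

Lemma tent_nat s (k : nat) : `|s - 2 * k%:R| <= 1 -> tent s = `|s - 2 * k%:R|.
Proof. exact: (@tent_eq s k). Qed.

Lemma near_even s (m : nat) : 0 <= s <= 2 * m%:R + 1 ->
  exists2 k : nat, (k <= m)%N & `|s - 2 * k%:R| <= 1.
Proof.
move=> /andP[s0 sm]; exists (minn m (Num.truncn ((s + 1) / 2))).
  exact: geq_minl.
have h0 : 0 <= (s + 1) / 2 by lra.
have /andP[] := truncn_itv h0; set k := Num.truncn _; rewrite -(natr1 k) => h1 h2.
rewrite ler_norml; case: leqP => [mk|km]; last by apply/andP; split; lra.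
have : m%:R <= k%:R :> R by rewrite ler_nat.
by move=> ?; apply/andP; split; lra.
Qed.

Lemma even_between s : -1 <= s -> exists k : nat, s <= 2 * k%:R <= s + 2.
Proof.
move=> s1; exists (Num.truncn ((s + 2) / 2)).
have h0 : 0 <= (s + 2) / 2 by lra.
have /andP[] := truncn_itv h0; set k := Num.truncn _; rewrite -(natr1 k) => ? ?.
by apply/andP; split; lra.
Qed.

Lemma tent_even (k : nat) : tent (2 * k%:R : R) = 0.
Proof. by rewrite (@tent_nat _ k) subrr normr0. Qed.

Lemma tent_odd (k : nat) : tent (2 * k%:R + 1 : R) = 1.
Proof.
have h : 2 * k%:R + 1 - 2 * k%:R = 1 :> R by ring.
by rewrite (@tent_nat _ k) h normr1.
Qed.

End Tent.

(** * The space of folded arrays and its metric *)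

Lemma small_tail (R : realType) (e : R) :
  0 < e -> exists J : nat, 4 / J.+1%:R < e.
Proof.
move=> e0; exists (Num.truncn (4 / e)).
by rewrite ltr_pdivrMr// mulrC -ltr_pdivrMr// truncnS_gt.
Qed.

(* The value [z i 0] lies in [0, 1] and drives the i-th block: all the
   coordinates [z i n] fold onto it. *)
Definition folded (R : realType) : set (nat -> nat -> R) :=
  [set z | forall i n, 0 <= z i n <= 4 * n%:R + 1 /\ tent (z i n) = z i 0%N].

Definition fold_space (R : realType) := {z | @folded R z}.

(** Entries of column [n] are below [4 * n.+1], so the square makes weighted differences vanish in
    both indices and the supremum metrizes the product topology. In column 0 the weight is exactly
    [i.+1%:R^-1]. *)
Definition weight (R : realType) (i n : nat) : R :=
  (i.+1%:R * n.+1%:R ^+ 2)^-1.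

Definition fold_dist (R : realType) (z w : fold_space R) : R :=
  sup [set weight R p.1 p.2 * `|sval z p.1 p.2 - sval w p.1 p.2| |
       p in [set: nat * nat]].

Section FoldDist.
Context {R : realType}.
Implicit Types z w : fold_space R.

Lemma fold_ge0 z i n : 0 <= sval z i n.
Proof. by case: (svalP z i n) => /andP[]. Qed.

Lemma fold_le z i n : sval z i n <= 4 * n%:R + 1.
Proof. by case: (svalP z i n) => /andP[]. Qed.

Lemma fold_tent z i n : tent (sval z i n) = sval z i 0%N.
Proof. by case: (svalP z i n). Qed.

Lemma fold_ext z w : (forall i n, sval z i n = sval w i n) -> z = w.
Proof.
case: z w => [z hz] [w hw] /= zw; apply: eq_exist => /=.
by apply/funext => i; apply/funext => n; exact: zw.
Qed.

Lemma weight_gt0 i n : 0 < weight R i n.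
Proof. by rewrite invr_gt0 mulr_gt0// exprn_gt0. Qed.

Lemma weight_le1 i n : weight R i n <= 1.
Proof.
rewrite invf_le1 ?mulr_gt0 ?exprn_gt0//.
by rewrite -natrX -natrM ler1n muln_gt0 expn_gt0.
Qed.

Lemma weight_fold_le z w i n :
  weight R i n * `|sval z i n - sval w i n| <= 4 / (i.+1%:R * n.+1%:R).
Proof.
have -> : 4 / (i.+1%:R * n.+1%:R) = weight R i n * (4 * n.+1%:R).
  by rewrite /weight; field; rewrite !nat1r !pnatr_eq0.
rewrite ler_wpM2l ?(ltW (weight_gt0 _ _))// -natr1.
have := fold_ge0 z i n; have := fold_le z i n.
have := fold_ge0 w i n; have := fold_le w i n.
by move=> ????; rewrite ler_norml; apply/andP; split; lra.
Qed.

(** One of the factors [i.+1], [n.+1] exceeds [J]. Hence, up to [4 / J.+1], only finitely many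
    coordinates count. *)
Lemma weight_fold_tail J z w i n : (J <= i)%N || (J <= n)%N ->
  weight R i n * `|sval z i n - sval w i n| <= 4 / J.+1%:R.
Proof.
move=> J_le; apply: (le_trans (weight_fold_le _ _ _ _)).
rewrite ler_pM2l// lef_pV2 ?posrE ?mulr_gt0// -natrM ler_nat.
by move: J_le; nia.
Qed.

Lemma fold_dist_ub z w i n :
  weight R i n * `|sval z i n - sval w i n| <= fold_dist z w.
Proof.
apply: ub_le_sup; last by exists (i, n).
exists 4 => _ [[j m] _ <-]; apply: (le_trans (weight_fold_le _ _ _ _)) => /=.
by rewrite ler_pdivrMr ?mulr_gt0// ler_peMr// -natrM ler1n.
Qed.

Lemma fold_dist_le z w c :
  (forall i n, weight R i n * `|sval z i n - sval w i n| <= c) ->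
  fold_dist z w <= c.
Proof.
move=> zwc; apply: ge_sup.
  exists (weight R 0 0 * `|sval z 0%N 0%N - sval w 0%N 0%N|).
  by exists (0%N, 0%N).
by move=> _ [[i n] _ <-]; exact: zwc.
Qed.

Lemma fold_dist_ge0 z w : 0 <= fold_dist z w.
Proof.
by apply: le_trans (fold_dist_ub z w 0 0); rewrite mulr_ge0// ltW// weight_gt0.
Qed.

Lemma fold_distxx z : fold_dist z z = 0.
Proof.
apply/eqP; rewrite eq_le fold_dist_ge0 andbT; apply: fold_dist_le => i n.
by rewrite subrr normr0 mulr0.
Qed.

Lemma fold_dist_eq0 z w : fold_dist z w = 0 -> z = w.
Proof.
move=> zw0; apply: fold_ext => i n; have := fold_dist_ub z w i n.
by rewrite zw0 pmulr_rle0 ?weight_gt0// normr_le0 subr_eq0 => /eqP.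
Qed.

Lemma fold_dist_sym z w : fold_dist z w = fold_dist w z.
Proof.
by apply/eqP; rewrite eq_le; apply/andP; split; apply: fold_dist_le => i n;
  rewrite distrC fold_dist_ub.
Qed.

Lemma fold_dist_triangle w z u :
  fold_dist z u <= fold_dist z w + fold_dist w u.
Proof.
apply: fold_dist_le => i n.
apply: le_trans (lerD (fold_dist_ub z w i n) (fold_dist_ub w u i n)).
rewrite -mulrDr ler_wpM2l ?(ltW (weight_gt0 _ _))//.
by rewrite (le_trans _ (ler_normD _ _))// addrA subrK.
Qed.

End FoldDist.

HB.instance Definition _ (R : realType) := gen_eqMixin (fold_space R).
HB.instance Definition _ (R : realType) := gen_choiceMixin (fold_space R).
HB.instance Definition _ (R : realType) := isMetric.Build R (fold_space R)
  (@fold_distxx R) (@fold_dist_eq0 R) (@fold_dist_sym R) (@fold_dist_triangle R).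

(** * Convergence and continuity of the coordinates *)

Section FoldTopology.
Context {R : realType}.
Local Notation X := (fold_space R).
Implicit Types z w : X.

Lemma fold_cvgP {T : Type} (F : set_system T) {FF : Filter F} (f : T -> X) z :
  (forall e : R, 0 < e -> \forall t \near F, fold_dist z (f t) <= e) ->
  f @ F --> z.
Proof. by move=> h; apply/metricType_numDomainType.cvgrPdist_le. Qed.

Lemma fold_near z (e : R) : 0 < e -> \forall w \near z, fold_dist z w <= e.
Proof.
move=> e0; have : nbhs z (ball z e) by exact: nbhsx_ballx.
by rewrite ballEmdist; apply: filterS => w /ltW.
Qed.

Lemma fold_lipschitz_continuous (f : X -> X) :
  (forall z w, fold_dist (f z) (f w) <= fold_dist z w) -> continuous f.
Proof.
move=> fL z; apply: (@fold_cvgP _ (nbhs z) _ f) => e e0.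
by apply: filterS (fold_near z e0) => w; apply: le_trans.
Qed.

Lemma fold_coord_continuous i n : continuous (fun z : X => sval z i n : R).
Proof.
move=> z; apply/(@cvgrPdist_le _ _ _ (nbhs z)) => e e0.
have e'0 : 0 < weight R i n * e by rewrite mulr_gt0 ?weight_gt0.
apply: filterS (fold_near z e'0) => w zw; rewrite -(ler_pM2l (weight_gt0 i n)).
exact: le_trans (fold_dist_ub z w i n) zw.
Qed.

End FoldTopology.

Lemma real_seq_seq_coord_continuous (R : realType) i n :
  continuous (fun z : real_seq_seq R => z i n : R).
Proof.
move=> z; apply: (@continuous_comp _ _ _
  (fun z : real_seq_seq R => z i) (fun y : real_seq R => y n)).
  exact: (@proj_continuous nat (fun=> real_seq R) i).
exact: (@proj_continuous nat (fun=> R) n).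
Qed.

(** * Even and odd points; compactness *)

Section FoldPoints.
Context {R : realType}.
Local Notation X := (fold_space R).
Implicit Types (u v z w : X) (k : nat -> nat -> nat).

(** The cap [n.*2] bounds the entries by [4 * n] for arbitrary [k], and at [n = 0] it makes the
    driving value 0, as the tent of an even integer must be. *)
Lemma even_folded k :
  @folded R (fun i n => 2 * (minn (k i n) n.*2)%:R).
Proof.
move=> i n; rewrite minn0 mulr0 tent_even; split=> //.
rewrite mulr_ge0//=.
have : (minn (k i n) n.*2)%:R <= (2 * n)%:R :> R.
  by rewrite ler_nat mul2n geq_minr.
by rewrite natrM => ?; lra.
Qed.

Definition even_pt k : X := exist _ _ (even_folded k).

Lemma odd_folded k :
  @folded R (fun i n => 2 * (minn (k i n) n.*2)%:R + 1).
Proof.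
move=> i n; rewrite minn0 mulr0 tent_odd add0r; split=> //.
rewrite addr_ge0 ?mulr_ge0//=.
have : (minn (k i n) n.*2)%:R <= (2 * n)%:R :> R.
  by rewrite ler_nat mul2n geq_minr.
by rewrite natrM => ?; lra.
Qed.

Definition odd_pt k : X := exist _ _ (odd_folded k).

(** The folded arrays are closed in a Tychonoff product of segments; the identity from the product
    topology to the metric is continuous on them. *)
Lemma fold_compact : compact [set: X].
Proof.
pose T : topologicalType := real_seq_seq R.
have ci i n : continuous (fun z : T => z i n : R).
  exact: real_seq_seq_coord_continuous.
have cl (f : T -> R) (D : set R) :
    continuous f -> closed D -> closed (f @^-1` D).
  by move=> cf cD; apply: preimage_closed => // z _; exact: cf.
have cF : compact (@folded R : set T).
  pose I n := `[0, 4 * n%:R + 1]%classic : set R.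
  have cB : compact [set z : T | forall i n, I n (z i n)].
    apply: (@tychonoff nat (fun=> real_seq R)
      (fun=> [set y | forall n, I n (y n)])) => _.
    by apply: (@tychonoff nat (fun=> R) I) => n; exact: segment_compact.
  apply: (subclosed_compact _ cB); last first.
    by move=> z zF i n; rewrite /I /= in_itv/=; have [] := zF i n.
  have -> : (@folded R : set T) = \bigcap_(p in [set: nat * nat])
    ([set z : T | 0 <= z p.1 p.2] `&`
     [set z : T | z p.1 p.2 <= 4 * p.2%:R + 1] `&`
     [set z : T | tent (z p.1 p.2) - z p.1 0%N = 0]).
    apply/seteqP; split => [z zF [i n] _ /=|z zF i n].
      by have [/andP[-> ->] ->] := zF i n; rewrite subrr.
    have [[h1 h2]] := zF (i, n) Logic.I => /subr0_eq h3.
    by split=> //; apply/andP; split.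
  apply: closed_bigI => -[i n] _ /=; apply: closedI; first apply: closedI.
  - exact: (cl _ [set x : R | 0 <= x] (ci i n) (@closed_ge R 0)).
  - exact: (cl _ [set x : R | x <= 4 * n%:R + 1] (ci i n) (@closed_le R _)).
  - apply: (cl (fun z : T => tent (z i n) - z i 0%N) [set x : R | x = 0]);
      last exact: closed_eq.
    move=> z; apply: (@cvgB R R^o T (nbhs z) _); last exact: ci.
    apply: (@continuous_comp _ _ _ (fun z : T => z i n) (@tent R)).
      exact: ci.
    exact: tent_continuous.
(* The default point makes [h] total; continuity is asked within [folded] only. *)
pose h (z : T) : X :=
  if pselect (folded z) is left p then exist _ z p
  else even_pt (fun _ _ => 0%N).
have hE (z : T) : folded z -> sval (h z) = z by rewrite /h; case: pselect.
have -> : [set: X] = h @` (@folded R : set T).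
  apply/seteqP; split => // z _; exists (sval z); first exact: svalP.
  by apply: fold_ext => i n; rewrite hE//; exact: svalP.
apply: continuous_compact cF; apply/subspace_continuousP => z zF.
apply: (@fold_cvgP _ _ (within (@folded R : set T) (nbhs z))) => e e0.
have [J /ltW Je] := small_tail e0.
have : \forall y \near (z : T), forall p : 'I_J * 'I_J,
    `|z p.1 p.2 - (y : T) p.1 p.2| <= e.
  apply: (@filter_forall _ _ _ (nbhs z)) => -[i n] /=.
  exact: (@cvgr_dist_le _ _ _ (nbhs z) _ (fun y : T => y i n : R) _ (ci i n z)).
move=> H; rewrite /within /= /prop_near1 /=; apply: filterS H => y zy yF.
apply: fold_dist_le => i n.
have [/andP[iJ nJ]|] := boolP ((i < J) && (n < J))%N.
  rewrite !hE//; apply: le_trans (zy (Ordinal iJ, Ordinal nJ)).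
  by rewrite ler_piMl ?weight_le1.
rewrite negb_and -!leqNgt => J_le; apply: le_trans Je.
exact: weight_fold_tail.
Qed.

End FoldPoints.

(** * Radial segments, walks between even points, connectedness *)

Section FoldPaths.
Context {R : realType}.
Local Notation X := (fold_space R).
Implicit Types (u v z w : X) (k : nat -> nat -> nat).

(** Within 1 of an even integer [tent] is the distance to it, so this set is a cone with apex
    [even_pt k]. *)
Definition in_star k z :=
  forall i n, `|sval z i n - sval (even_pt k : X) i n| <= 1.

(* On each block the radial segment from an even point scales the common
   folded value, hence stays in the space. *)
Lemma radial_folded k z (s : R) : in_star k z -> 0 <= s <= 1 ->
  @folded R (fun i n => sval (even_pt k : X) i n +
    s * (sval z i n - sval (even_pt k : X) i n)).
Proof.
move=> kz /andP[s0 s1] i n.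
have b0 := fold_ge0 (even_pt k : X) i n; have b1 := fold_le (even_pt k : X) i n.
have z0 := fold_ge0 z i n; have z1 := fold_le z i n.
split.
  by set b := sval (even_pt k : X) i n in b0 b1 *; apply/andP; split; nra.
have tE j m : tent (sval (even_pt k : X) j m +
    s * (sval z j m - sval (even_pt k : X) j m)) = s * sval z j 0%N.
  set b := sval (even_pt k : X) j m.
  have e : b + s * (sval z j m - b) - b = s * (sval z j m - b) by ring.
  have h : `|b + s * (sval z j m - b) - b| <= 1.
    rewrite e normrM ger0_norm// (le_trans _ (kz j m))//.
    by rewrite ler_piMl.
  rewrite (tent_nat h) e normrM ger0_norm//.
  by rewrite -(fold_tent z j m) (tent_nat (kz j m)).
rewrite tE /= minn0 mulr0 add0r subr0//.
Qed.

(** Clamping extends the segment parameter from [[0, 1]] to all reals without losing the Lipschitz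
    bound, so that [radial] is a total function. *)
Definition clamp01 (s : R) : R := Num.max 0 (Num.min 1 s).

Lemma clamp01_itv s : 0 <= clamp01 s <= 1.
Proof. by rewrite /clamp01 le_max lexx/= ge_max ler01 ge_min lexx. Qed.

Lemma clamp01_id s : 0 <= s <= 1 -> clamp01 s = s.
Proof. by move=> /andP[s0 s1]; rewrite /clamp01 min_r// max_r. Qed.

Lemma clamp01_lip s t : `|clamp01 s - clamp01 t| <= `|s - t|.
Proof.
have := lexx `|s - t|; rewrite /clamp01 ler_norml => /andP[h1 h2].
rewrite ler_norml; case: (leP 1 s) => s1; case: (leP 1 t) => t1.
- by rewrite !max_r//; apply/andP; split; lra.
- by rewrite max_r//; case: (leP 0 t) => t0; apply/andP; split; lra.
- rewrite [Num.max 0 1]max_r//.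
  by case: (leP 0 s) => s0; apply/andP; split; lra.
- by case: (leP 0 s) => s0; case: (leP 0 t) => t0; apply/andP; split; lra.
Qed.

Definition radial k z (kz : in_star k z) (s : R) : X :=
  exist _ _ (radial_folded kz (clamp01_itv s)).

Lemma radial0 k z (kz : in_star k z) : radial kz 0 = even_pt k.
Proof.
by apply: fold_ext => i n /=; rewrite clamp01_id ?lexx ?ler01// mul0r addr0.
Qed.

Lemma radial1 k z (kz : in_star k z) : radial kz 1 = z.
Proof.
by apply: fold_ext => i n /=; rewrite clamp01_id ?lexx ?ler01// mul1r subrKC.
Qed.

Lemma radial_dist k z (kz : in_star k z) s t :
  fold_dist (radial kz s) (radial kz t) <= `|s - t|.
Proof.
apply: fold_dist_le => i n.
apply: (@le_trans _ _ `|clamp01 s - clamp01 t|); last exact: clamp01_lip.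
apply: (@le_trans _ _ `|sval (radial kz s) i n - sval (radial kz t) i n|).
  by rewrite ler_piMl ?weight_le1.
rewrite /= opprD addrACA subrr add0r -mulrBl normrM.
by rewrite ler_piMr//; exact: kz.
Qed.

Lemma radial_continuous k z (kz : in_star k z) : continuous (radial kz).
Proof.
move=> s; apply: (@fold_cvgP _ _ (nbhs s)) => e e0; near=> t.
apply: (le_trans (radial_dist kz s t)); near: t.
exact: cvgr_dist_le.
Unshelve. all: by end_near. Qed.

Lemma radial_continuum k z (kz : in_star k z) (a b : R) : a <= b ->
  continuum (radial kz @` `[a, b]).
Proof.
have rc : {within `[a, b], continuous (radial kz)}.
  exact: continuous_subspaceT (@radial_continuous k z kz).
move=> ab; split; first by exists (radial kz a), a => //=; rewrite in_itv/= lexx.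
- by apply: (@continuous_compact R X (radial kz) _ rc); exact: segment_compact.
- apply: (@connected_continuous_connected R X _ (radial kz) _ rc).
  exact: segment_connected.
Qed.

Lemma near_even_pt z : exists k, in_star k z.
Proof.
have h i n : exists m, (m <= n.*2)%N /\ `|sval z i n - 2 * m%:R| <= 1.
  have [|m mn mz] := @near_even R (sval z i n) n.*2; last by exists m.
  rewrite fold_ge0/= (le_trans (fold_le z i n))// -mul2n natrM; lra.
have /choice[k hk] : forall i, exists f : nat -> nat, forall n,
    (f n <= n.*2)%N /\ `|sval z i n - 2 * (f n)%:R| <= 1.
  by move=> i; have [f fP] := choice (h i); exists f.
by exists k => i n; have [kn kz] := hk i n; rewrite /= (minn_idPl kn).
Qed.

(** Reduces a relation between uniformly close points to radial segments; it serves both for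
    connected components and for chains of small continua. *)
Lemma radial_induction (P : X -> X -> Prop) :
  (forall z, P z z) -> (forall z w, P z w -> P w z) ->
  (forall w z u, P z w -> P w u -> P z u) ->
  (forall k z, in_star k z -> P (even_pt k) z) ->
  forall u v M, (forall i n, `|sval u i n - sval v i n| <= M) -> P u v.
Proof.
move=> Pr Ps Pt Pk u v M uvM.
have [k ku] := near_even_pt u; have [l lv] := near_even_pt v.
suff : P (even_pt k) (even_pt l).
  by move=> Pkl; exact: Pt (Pt _ _ _ (Ps _ _ (Pk _ _ ku)) Pkl) (Pk _ _ lv).
(* After capping, the entries of the even points are exactly twice the indices, so bounds on entries
   become bounds on indices. *)
pose kk i n := minn (k i n) n.*2; pose ll i n := minn (l i n) n.*2.
have kkE : even_pt kk = even_pt k :> X.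
  by apply: fold_ext => i n /=; rewrite /kk -minnA minnn.
have llE : even_pt ll = even_pt l :> X.
  by apply: fold_ext => i n /=; rewrite /ll -minnA minnn.
rewrite -kkE -llE.
have [N kN] : exists N, forall i n,
    (kk i n <= ll i n + N)%N /\ (ll i n <= kk i n + N)%N.
  (* Each point is within 1 of its even point, so the even entries differ by at most [M + 2]. *)
  exists (Num.truncn (M + 2)).+1 => i n; rewrite -!(ler_nat R) !natrD.
  have := truncnS_gt (M + 2); set N := (Num.truncn _).+1%:R => MN.
  have := uvM i n; have := ku i n; have := lv i n => /=.
  rewrite !ler_norml /kk /ll => /andP[? ?] /andP[? ?] /andP[? ?].
  by split; lra.
(* Walk from kk to ll, moving every coordinate by at most one even integer at
   a time through a common odd point. *)
move: kk kN {kkE llE} => kk; elim: N kk => [|N IH] kk kN.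
  have -> : kk = ll; last exact: Pr.
  by apply/funext => i; apply/funext => n; have := kN i n; rewrite !addn0; lia.
(* [m] is [kk] projected onto the interval of radius [N] around [ll]; as [kk] lies within [N.+1] of
   [ll], it moves by at most 1. *)
pose m i n := maxn (minn (kk i n) (ll i n + N)) (ll i n - N).
apply: (Pt (even_pt m)); last first.
  by apply: IH => i n; have := kN i n; rewrite /m; lia.
pose c i n := minn (kk i n) (m i n).
have star (p q : nat) : (p = q)%N \/ (p = q.+1)%N ->
    `|(2 * q%:R + 1) - 2 * p%:R| <= 1 :> R.
  by move=> [->|->]; rewrite ?(natrS _ q) ler_norml; apply/andP; split; lra.
apply: (Pt (odd_pt c)); [|apply: Ps]; apply: Pk => i n; apply: star;
  by have := kN i n; rewrite /c /m; lia.
Qed.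

(** The driving value is its own tent, so it may replace all far coordinates of its block; the
    result is a bounded array close to [z]. *)
Definition trunc_fun (J : nat) z i n : R :=
  if (n <= J)%N then sval z i n else sval z i 0%N.

Lemma trunc_folded J z : @folded R (trunc_fun J z).
Proof.
move=> i n; rewrite /trunc_fun leq0n; case: ifP => _; first exact: (svalP z i n).
rewrite fold_tent fold_ge0 (le_trans (fold_le z i 0%N))//.
by rewrite mulr0 add0r lerDr mulr_ge0.
Qed.

(** Bounded arrays lie in the component of the zero array and are dense, while components are
    closed. *)
Lemma fold_connected : connected [set: X].
Proof.
pose o : X := even_pt (fun _ _ => 0%N).
pose C := connected_component [set: X] o.
have Cbd z M : (forall i n, `|sval z i n| <= M) -> C z.
  move=> zM; apply: (@radial_induction (connected_component [set: X])) (M) _.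
  - by move=> ?; exact: connected_component_refl.
  - exact: connected_component_sym.
  - move=> ? ? ?; exact: connected_component_trans.
  - move=> k w kw; exists (radial kw @` `[0, 1]).
      split=> //; last by have [] := radial_continuum kw (@ler01 R).
      by exists 0 => //=; [rewrite in_itv/= lexx ler01|exact: radial0].
    by exists 1 => //=; [rewrite in_itv/= lexx ler01|exact: radial1].
  - by move=> i n /=; rewrite min0n mulr0 sub0r normrN.
have -> : [set: X] = C; last exact: component_connected.
apply/seteqP; split => // z _.
have /(_ z) : closure C `<=` C by exact: component_closed closedT.
apply => B /nbhs_ballP[e /= e0 zeB].
have [J Je] := small_tail e0.
exists (exist _ _ (trunc_folded J z)); split.
  apply: (Cbd _ (4 * J%:R + 1)) => i n /=; rewrite /trunc_fun; case: ifP => nJ.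
    rewrite ger0_norm ?fold_ge0// (le_trans (fold_le z i n))//.
    by rewrite lerD2r ler_pM2l// ler_nat.
  rewrite ger0_norm ?fold_ge0// (le_trans (fold_le z i 0%N))//.
  by rewrite lerD2r ler_pM2l// ler_nat.
apply: zeB; rewrite ballEmdist /=; apply: le_lt_trans Je.
apply: fold_dist_le => i n; have [nJ|Jn] := leqP n J.
  by rewrite /= /trunc_fun nJ subrr normr0 mulr0 divr_ge0.
by apply: weight_fold_tail; rewrite (ltnW Jn) orbT.
Qed.

Lemma fold_continuum : continuum [set: X].
Proof.
split; [by exists (even_pt (fun _ _ => 0%N))|exact: fold_compact|].
exact: fold_connected.
Qed.

End FoldPaths.

(** * Chains of small continua *)

Section EpsChain.
Context {R : realType} {X : metricType R}.
Implicit Types (x y z : X) (K : set X) (e : R).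

Lemma diameter_le K e : (forall x y, K x -> K y -> mdist x y <= e) ->
  (diameter K <= e%:E)%E.
Proof.
by move=> h; apply: ge_ereal_sup => _ [[x y] [/= Kx Ky] <-]; rewrite lee_fin h.
Qed.

Lemma mdist_lt_diameter K e x y : (diameter K < e%:E)%E -> K x -> K y ->
  mdist x y < e.
Proof.
move=> Ke Kx Ky; rewrite -lte_fin; apply: le_lt_trans Ke.
by apply: ereal_sup_ubound; exists (x, y).
Qed.

Definition eps_linked e x y :=
  exists K, [/\ continuum K, (diameter K < e%:E)%E, K x & K y].

(** The inductive form makes concatenation and reversal immediate; [eps_chain_continua] recovers the
    indexed chains. *)
Inductive eps_chain e x : X -> Prop :=
| eps_chain_refl : eps_chain e x x
| eps_chain_rcons y z : eps_chain e x y -> eps_linked e y z -> eps_chain e x z.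

Lemma eps_linked_chain e x y : eps_linked e x y -> eps_chain e x y.
Proof. exact/eps_chain_rcons/eps_chain_refl. Qed.

Lemma eps_chain_trans e y x z :
  eps_chain e x y -> eps_chain e y z -> eps_chain e x z.
Proof.
by move=> xy; elim=> // {}z t _ xz zt; exact: eps_chain_rcons xz zt.
Qed.

Lemma eps_chain_sym e x y : eps_chain e x y -> eps_chain e y x.
Proof.
elim=> [|{}y z _ yx [K [cK Ke Ky Kz]]]; first exact: eps_chain_refl.
by apply: eps_chain_trans yx; apply: eps_linked_chain; exists K.
Qed.

Lemma eps_chain_continua e x y : 0 < e -> eps_chain e x y ->
  exists (n : nat) (K : nat -> set X),
    [/\ forall i, (i <= n)%N -> continuum (K i) /\ (diameter (K i) < e%:E)%E,
        K 0%N x,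
        K n y &
        forall i, (i < n)%N -> K i `&` K i.+1 !=set0].
Proof.
move=> e0; elim=> [|{}y z _ [n [K [cK Kx Ky KK]]] [L [cL Le Ly Lz]]].
  exists 0%N, (fun=> [set x]); split=> // i _; split.
    by split; [exists x|exact: compact_set1|exact: connected1].
  apply: (@le_lt_trans _ _ 0%:E); last by rewrite lte_fin.
  by apply: diameter_le => _ _ -> ->; rewrite mdistxx.
exists n.+1, (fun i => if (i <= n)%N then K i else L).
rewrite leq0n ltnn; split=> // i.
  by have [iN _|//] := leqP i n; exact: cK.
rewrite ltnS => iN; rewrite iN; have [ni|ni] := ltnP i n; first exact: KK.
have -> : i = n by apply/eqP; rewrite eqn_leq iN.
by exists y.
Qed.

End EpsChain.

(** * Chain connection is blockwise bounded difference *)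

Section FoldChains.
Context {R : realType}.
Local Notation X := (fold_space R).
Implicit Types (u v z w : X) (k : nat -> nat -> nat).

Lemma small_continuum_coord (K : set X) u v i n :
  continuum K -> (diameter K < (i.+1%:R^-1)%:E)%E -> K u -> K v ->
  `|sval u i n - sval v i n| <= 2.
Proof.
move=> [_ _ cK] Ki.
(* Otherwise the i-th driving value takes both values 0 and 1 on K. *)
wlog uv : u v / sval v i n <= sval u i n.
  move=> h Ku Kv; have [/h->//|/ltW/h] := leP (sval v i n) (sval u i n).
  by rewrite distrC; apply.
move=> Ku Kv; rewrite ger0_norm ?subr_ge0// leNgt; apply/negP => uv2.
have /connected_intervalP itv : connected ((fun z : X => sval z i n : R) @` K).
  apply: (connected_continuous_connected cK).
  exact/continuous_subspaceT/fold_coord_continuous.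
have hit (s : R) : sval v i n <= s <= sval v i n + 2 ->
    exists2 z, K z & sval z i n = s.
  move=> /andP[vs sv].
  have [||//|z Kz <-] := itv (sval v i n) (sval u i n) _ _ s; last by exists z.
  - by exists v.
  - by exists u.
  - by apply/andP; split; lra.
have v0 := fold_ge0 v i n.
have [|p] := @even_between R (sval v i n); first lra.
move=> /hit[z Kz zp].
(* The shift by 1 turns an even integer into the odd integer [2 * q + 1] within 2 above
   [sval v i n]. *)
have [|q /andP[q1 q2]] := @even_between R (sval v i n - 1); first lra.
have [|w Kw wq] := hit (2 * q%:R + 1); first by apply/andP; split; lra.
(* The driving values of [w] and [z] are 1 and 0, so their distance is at least the weight
   [i.+1%:R^-1], against the diameter bound. *)
have := le_lt_trans (fold_dist_ub w z i 0%N) (mdist_lt_diameter Ki Kw Kz).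
rewrite -(fold_tent z i n) -(fold_tent w i n) zp wq tent_even tent_odd.
by rewrite subr0 normr1 /weight expr1n !mulr1 ltxx.
Qed.

Definition splice_fun (I : nat) u z i n : R :=
  if (i < I)%N then sval u i n else sval z i n.

Lemma splice_folded I u z : @folded R (splice_fun I u z).
Proof.
move=> i n; rewrite /splice_fun; case: ifP => _.
  exact: (svalP u i n).
exact: (svalP z i n).
Qed.

Definition splice I u z : X := exist _ _ (splice_folded I u z).

Lemma splice_continuous I u : continuous (splice I u).
Proof.
apply: fold_lipschitz_continuous => z w; apply: fold_dist_le => i n.
rewrite /= /splice_fun; case: ifP => _; last exact: fold_dist_ub.
by rewrite subrr normr0 mulr0 fold_dist_ge0.
Qed.

(** The continuum is the image of the whole space under [splice I u]: it contains [u] as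
    [splice I u u], and its points differ only in blocks of index at least [I]. *)
Lemma splice_linked I u v e : 4 / I.+1%:R < e -> eps_linked e u (splice I u v).
Proof.
move=> Ie; have sc : {within [set: X], continuous (splice I u)}.
  exact/continuous_subspaceT/splice_continuous.
exists (splice I u @` [set: X]); split.
- split; first by exists (splice I u u), u.
    exact: continuous_compact sc fold_compact.
  exact: connected_continuous_connected fold_connected sc.
- apply: (@le_lt_trans _ _ (4 / I.+1%:R)%:E); last by rewrite lte_fin.
  apply: diameter_le => _ _ [z _ <-] [w _ <-]; apply: fold_dist_le => i n.
  have [iI|Ii] := ltnP i I.
    by rewrite /= /splice_fun iI subrr normr0 mulr0 divr_ge0.
  by apply: weight_fold_tail; rewrite Ii.
- exists u => //; apply: fold_ext => i n /=.
  by rewrite /splice_fun; case: ifP.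
- by exists v.
Qed.

Lemma radial_chain e k z : 0 < e -> in_star k z -> eps_chain e (even_pt k) z.
Proof.
move=> e0 kz; pose N := (Num.truncn e^-1).+1.
have N0 : 0 < N%:R :> R by rewrite ltr0n.
have Ne : N%:R^-1 < e by rewrite invf_plt// truncnS_gt.
have h j : eps_chain e (even_pt k) (radial kz (j%:R / N%:R)).
  elim: j => [|j IH]; first by rewrite mul0r radial0; exact: eps_chain_refl.
  apply: eps_chain_rcons IH _.
  pose a : R := j%:R / N%:R; pose b : R := j.+1%:R / N%:R.
  have ba : b - a = N%:R^-1.
    by rewrite /a /b -mulrBl -natr1 addrAC subrr add0r mul1r.
  have ab : a <= b by rewrite -subr_ge0 ba invr_ge0 ltW.
  exists (radial kz @` `[a, b]); split; first exact: radial_continuum.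
  - apply: (@le_lt_trans _ _ (N%:R^-1)%:E); last by rewrite lte_fin.
    apply: diameter_le => _ _ [s + <-] [t + <-]; rewrite /= !in_itv/=.
    move=> /andP[? ?] /andP[? ?]; apply: (le_trans (radial_dist _ _ _)).
    by rewrite -ba ler_norml; apply/andP; split; lra.
  - by exists a => //; rewrite /= in_itv/= lexx.
  - by exists b => //; rewrite /= in_itv/= lexx andbT.
by have := h N; rewrite divff ?gt_eqF// radial1.
Qed.

Lemma eq_mod_linftyP (x y : nat -> R) :
  eq_mod_linfty x y <-> exists M : R, forall n, `|x n - y n| <= M.
Proof.
have pf : ProperFilter (globally [set: nat]).
  exact: (globally_properfilter (a := 0%N)).
have [h1 h2] := @ex_bound nat R R^o (fun n => x n - y n) _ pf; split.
  by move=> /h1[M h]; exists M => n; exact: h.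
by move=> [M h]; apply: h2; exists M => n _; exact: h.
Qed.

Lemma fold_chainP u v : chain_continuum_connected u v <->
  rel_power (@eq_mod_linfty R) (sval u) (sval v).
Proof.
split=> [uv i|uv e e0].
  have /uv[n [K [cK Ku Kv KK]]] : 0 < i.+1%:R^-1 :> R by rewrite invr_gt0.
  (* Each of the [n.+1] continua moves a coordinate of block [i] by at most 2, and [n] does not
     depend on [m]. *)
  apply/eq_mod_linftyP; exists (2 * n.+1%:R) => m.
  have : forall j, (j <= n)%N -> forall z, K j z ->
      `|sval u i m - sval z i m| <= 2 * j.+1%:R.
    elim=> [jn z Kz|j IH jn z Kz].
      by have [c d] := cK _ jn; rewrite mulr1; exact: small_continuum_coord d _ _.
    have [w [Kw Kw']] := KK _ jn; have := IH (ltnW jn) w Kw.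
    have [c d] := cK _ jn; have := small_continuum_coord m c d Kw' Kz.
    rewrite -(natr1 j.+1) mulrDr mulr1 => h1 h2.
    apply: le_trans (lerD h2 h1).
    by rewrite (le_trans _ (ler_normD _ _))// addrA subrK.
  by move=> /(_ n (leqnn n) v Kv).
apply: eps_chain_continua => //.
(* A single small continuum adjusts all blocks of index >= I; on the remaining
   finitely many blocks the difference is uniformly bounded. *)
have [I Ie] := small_tail e0.
apply: eps_chain_trans (eps_linked_chain (splice_linked u v Ie)) _.
have [M [M0 hM]] : exists M : R, 0 <= M /\ forall i n, (i < I)%N ->
    `|sval u i n - sval v i n| <= M.
  elim: I {Ie} => [|I [M [M0 hM]]]; first by exists 0.
  have /eq_mod_linftyP[M' hM'] := uv I.
  exists (Num.max M M'); rewrite le_max M0; split=> // i n.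
  rewrite ltnS leq_eqVlt le_max => /predU1P[->|iI]; first by rewrite hM' orbT.
  by rewrite hM.
apply: (@radial_induction _ (eps_chain e)) (M) _.
- exact: eps_chain_refl.
- exact: eps_chain_sym.
- exact: eps_chain_trans.
- by move=> k z; exact: radial_chain.
- move=> i n /=; rewrite /splice_fun; case: ifP => iI; first exact: hM.
  by rewrite subrr normr0.
Qed.

End FoldChains.

(** * Continuity into products; Borel sets and maps *)

Lemma prod_topology_continuous (S Y : topologicalType)
    (f : S -> prod_topology (fun _ : nat => Y)) :
  (forall i, continuous (fun x => f x i)) -> continuous f.
Proof.
move=> cf x; apply/cvg_sup => i.
have surj : @^~ i @` [set: nat -> Y] = [set: Y].
  by apply/seteqP; split => // y _; exists (fun=> y).
apply/(@cvg_image _ _ (fun g : nat -> Y => g i) (f @ x) (f x) _ surj).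
move=> A /cf fA; exists ((fun g : nat -> Y => g i) @^-1` A) => //.
exact: image_preimage.
Qed.

Section BorelSets.
Context {X : topologicalType}.
Implicit Types A B : set X.

Lemma borel_open A : open A -> <<s @open X >> A.
Proof. exact: sub_gen_smallest. Qed.

Lemma borelC A : <<s @open X >> A -> <<s @open X >> (~` A).
Proof.
have [_ C _] := smallest_sigma_algebra [set: X] (@open X).
by move=> /C; rewrite setTD.
Qed.

Lemma borel0 : <<s @open X >> (@set0 X).
Proof. by have [] := smallest_sigma_algebra [set: X] (@open X). Qed.

Lemma borel_bigcup_nat (F : nat -> set X) :
  (forall n, <<s @open X >> (F n)) -> <<s @open X >> (\bigcup_n F n).
Proof. by have [_ _] := smallest_sigma_algebra [set: X] (@open X); exact. Qed.

Lemma borel_bigcup (I : countType) (F : I -> set X) :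
  (forall i, <<s @open X >> (F i)) -> <<s @open X >> (\bigcup_i F i).
Proof.
move=> bF.
have -> : \bigcup_i F i =
    \bigcup_n (if unpickle n is Some i then F i else set0).
  apply/seteqP; split => x [n _].
    by exists (pickle n) => //; rewrite pickleK.
  by case: unpickle => // i Fi; exists i.
by apply: borel_bigcup_nat => n; case: unpickle => // *; exact: borel0.
Qed.

Lemma borel_bigcap (I : countType) (F : I -> set X) :
  (forall i, <<s @open X >> (F i)) -> <<s @open X >> (\bigcap_i F i).
Proof.
move=> bF; rewrite -[X in <<s _ >> X]setCK setC_bigcap.
by apply: borelC; apply: borel_bigcup => i; exact: borelC.
Qed.

Lemma borelI A B :
  <<s @open X >> A -> <<s @open X >> B -> <<s @open X >> (A `&` B).
Proof.
move=> bA bB; have -> : A `&` B = \bigcap_b (if b then A else B).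
  apply/seteqP; split => [x [Ax Bx] [] //|x h].
  by split; [exact: (h true)|exact: (h false)].
by apply: borel_bigcap => -[].
Qed.

Lemma borel_closed A : closed A -> <<s @open X >> A.
Proof.
by move=> cA; rewrite -[A]setCK; apply: borelC; apply: borel_open; exact: closed_openC.
Qed.

End BorelSets.

Lemma open_borel_fun (X Y : topologicalType) (f : X -> Y) :
  (forall U : set Y, open U -> <<s @open X >> (f @^-1` U)) -> borel_fun f.
Proof.
move=> fU; suff : <<s @open Y >> `<=` [set B | <<s @open X >> (f @^-1` B)] by [].
apply: smallest_sub => //.
split=> [|A|F].
- by rewrite /= preimage_set0; exact: borel0.
- by rewrite /= setTD preimage_setC; exact: borelC.
- by move=> h; rewrite /= preimage_bigcup; exact: borel_bigcup_nat.
Qed.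

(** * The two Borel reductions *)

Section Coding.
Context {R : realType}.
Local Notation X := (fold_space R).

Lemma fold_val_borel : borel_fun (@sval _ _ : X -> real_seq_seq R).
Proof.
apply: open_borel_fun => U oU; apply: borel_open; apply: open_comp => // z _.
apply: prod_topology_continuous => {z} i.
by apply: prod_topology_continuous => n; exact: fold_coord_continuous.
Qed.

(** The 2-adic valuation of [n.+1] takes every value infinitely often, so each coordinate of a
    sequence gets repeated at arbitrarily large positions. *)
Definition ruler (n : nat) : nat := logn 2 n.+1.

Lemma ruler_large (n N : nat) : exists2 m, (N <= m)%N & ruler m = n.
Proof.
have h : (0 < 2 ^ n * N.*2.+1)%N by rewrite muln_gt0 expn_gt0.
exists (2 ^ n * N.*2.+1).-1.
  have : (1 * N.*2.+1 <= 2 ^ n * N.*2.+1)%N by rewrite leq_mul2r expn_gt0.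
  by lia.
rewrite /ruler prednK// lognM ?expn_gt0// pfactorK// logn_coprime ?addn0//.
by rewrite coprime2n /= odd_double.
Qed.

(** The integer part of [r], truncated to [[-m, m]] and shifted by [m]; [truncn] sends negative
    reals to 0, and the upper cap is that of [even_pt]. *)
Definition digit (m : nat) (r : R) : nat :=
  minn (Num.truncn (r + m%:R)) m.*2.

Lemma digit_ge m c r : (c <= digit m r)%N =
  (c == 0%N) || (c <= m.*2)%N && (c%:R <= r + m%:R).
Proof.
case: c => [//|c]; rewrite /digit leq_min /= andbC.
by rewrite -truncn_gt_nat.
Qed.

Lemma digit_lip m r s : `|(digit m r)%:R - (digit m s)%:R| <= `|r - s| + 1 :> R.
Proof.
wlog rs : r s / r <= s.
  move=> h; have [/h//|/ltW/h] := leP r s.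
  by rewrite distrC (distrC s).
rewrite (ler0_norm (_ : r - s <= 0)) ?subr_le0//.
have : (digit m r <= digit m s)%N.
  by rewrite /digit leq_min geq_minr andbT geq_min le_truncn// lerD2r.
rewrite -(ler_nat R) => le_rs.
suff : (digit m s)%:R - (digit m r)%:R <= s - r + 1 :> R.
  by move=> ?; rewrite ler_norml; apply/andP; split; lra.
have ra := truncnS_gt (r + m%:R).
have sb : (Num.truncn (s + m%:R))%:R <= (Num.truncn (r + m%:R)).+1%:R + (s - r).
  have [s0|s0] := leP 0 (s + m%:R).
    by move: s0; rewrite -truncn_le => ?; lra.
  have -> : Num.truncn (s + m%:R) = 0%N by apply/truncn0Pn; rewrite -ltNge; lra.
  by rewrite addr_ge0// subr_ge0.
(* If the digit of [r] is at the cap, the digit of the larger [s] cannot exceed it. *)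
have [rm|/ltnW rm] := leqP (Num.truncn (r + m%:R)) m.*2; last first.
  have : (digit m s)%:R <= (digit m r)%:R :> R.
    by rewrite ler_nat /digit (minn_idPr rm) geq_minr.
  by move=> ?; lra.
have : (digit m s)%:R <= (Num.truncn (s + m%:R))%:R :> R.
  by rewrite ler_nat geq_minl.
have -> : digit m r = Num.truncn (r + m%:R) := minn_idPl rm.
by move: sb; rewrite -natr1 => *; lra.
Qed.

Lemma digit_exact m r s : `|r| <= m%:R -> `|s| <= m%:R ->
  `|r - s| <= `|(digit m r)%:R - (digit m s)%:R| + 1.
Proof.
have h (t : R) : `|t| <= m%:R ->
    (digit m t)%:R <= t + m%:R < (digit m t)%:R + 1.
  rewrite ler_norml => /andP[t1 t2]; have t0 : 0 <= t + m%:R by lra.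
  have /andP[h1 h2] := truncn_itv t0; rewrite /digit (minn_idPl _) ?natr1 ?h1//.
  rewrite -(ler_nat R) (le_trans h1)// -addnn natrD; lra.
move=> /h/andP[r1 r2] /h/andP[s1 s2].
set a := (digit m r)%:R in r1 r2 *; set b := (digit m s)%:R in s1 s2 *.
have := lexx `|a - b|; rewrite {1}ler_norml => /andP[? ?].
by rewrite ler_norml; apply/andP; split; lra.
Qed.

Definition encode (x : real_seq_seq R) : X :=
  even_pt (fun i n => digit n (x i (ruler n))).

(** The set is a difference of two threshold sets, each one closed, empty or everything. *)
Lemma borel_digit_eq i n c :
  <<s @open (real_seq_seq R) >> [set x | digit n (x i (ruler n)) = c].
Proof.
have ge d : <<s @open (real_seq_seq R) >>
    [set x | (d <= digit n (x i (ruler n)))%N].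
  have [d0|d0] := eqVneq d 0%N.
    rewrite (_ : [set _ | _] = ~` set0); first by apply: borelC; exact: borel0.
    by apply/seteqP; split => [x _ []|x _] //=; rewrite d0.
  have [dn|dn] := leqP d n.*2; last first.
    rewrite (_ : [set _ | _] = set0); first exact: borel0.
    apply/seteqP; split => // x; rewrite /= digit_ge (negPf d0)/= leqNgt dn.
    by [].
  rewrite (_ : [set _ | _] =
      (fun x : real_seq_seq R => x i (ruler n)) @^-1`
        [set r | d%:R - n%:R <= r]).
    apply: borel_closed; apply: preimage_closed; last exact: closed_ge.
    move=> x _; exact: real_seq_seq_coord_continuous.
  by apply/seteqP; split => x; rewrite /= digit_ge (negPf d0)/= dn/= lerBlDr.
rewrite (_ : [set _ | _] = [set x | (c <= digit n (x i (ruler n)))%N] `&`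
    ~` [set x | (c.+1 <= digit n (x i (ruler n)))%N]).
  by apply: borelI => //; exact: borelC.
apply/seteqP; split => x /=; first by move=> ->; rewrite leqnn ltnn.
by move=> [c1 /negP]; rewrite -leqNgt => c2; apply/eqP; rewrite eqn_leq c1 c2.
Qed.

(* Membership of [encode x] in an open set is witnessed by finitely many
   digits, and there are countably many finite blocks [(J, a)] of digits. *)
Lemma encode_borel : borel_fun encode.
Proof.
apply: open_borel_fun => U oU.
pose block := {J : nat & {ffun 'I_J * 'I_J -> nat}}.
pose good (t : block) := forall k : nat -> nat -> nat,
  (forall p : 'I_(tag t) * 'I_(tag t), k p.1 p.2 = tagged t p) -> 
  U (even_pt k).
pose cell (t : block) : set (real_seq_seq R) :=
  if pselect (good t) then
    \bigcap_(p : 'I_(tag t) * 'I_(tag t))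
      [set x | digit p.2 (x p.1 (ruler p.2)) = tagged t p]
  else set0.
have -> : encode @^-1` U = \bigcup_t cell t.
  apply/seteqP; split => [x Ux|x [t _]]; last first.
    rewrite /cell; case: pselect => [gt h|//]; apply: (gt) => p.
    exact: (h p).
  have /nbhs_ballP[e /= e0 xeU] := open_nbhs_nbhs (conj oU Ux).
  have [J Je] := small_tail e0.
  pose t : block := Tagged (fun J => {ffun 'I_J * 'I_J -> nat})
    [ffun p : 'I_J * 'I_J => digit p.2 (x p.1 (ruler p.2))].
  exists t => //; rewrite /cell; case: pselect => [gt p _ /=|].
    by rewrite ffunE.
  case=> k hk; apply: xeU; rewrite ballEmdist /=.
  apply: le_lt_trans Je; apply: fold_dist_le => i n.
  have [/andP[iJ nJ]|] := boolP ((i < J) && (n < J))%N.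
    have := hk (Ordinal iJ, Ordinal nJ); rewrite /= ffunE /= => ->.
    by rewrite subrr normr0 mulr0 divr_ge0.
  by rewrite negb_and -!leqNgt => J_le; exact: weight_fold_tail.
apply: borel_bigcup => t; rewrite /cell; case: pselect => gt; last exact: borel0.
by apply: borel_bigcap => p; exact: borel_digit_eq.
Qed.

(** Taking digits costs at most 1. Conversely, column [n] of a block is read off at a position [m]
    with [ruler m = n], so large that neither value is truncated; the bound [M] is the same for all
    [n]. *)
Lemma encodeP (x y : real_seq_seq R) : rel_power (@eq_mod_linfty R) x y <->
  rel_power (@eq_mod_linfty R) (sval (encode x)) (sval (encode y)).
Proof.
have dE (z : real_seq_seq R) i n :
    sval (encode z) i n = 2 * (digit n (z i (ruler n)))%:R.
  by rewrite /= /digit -minnA minnn.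
split=> xy i; have /eq_mod_linftyP[M hM] := xy i; apply/eq_mod_linftyP.
  exists (2 * (M + 1)) => n; rewrite !dE -mulrBr normrM ger0_norm// ler_pM2l//.
  by rewrite (le_trans (digit_lip _ _ _))// lerD2r.
exists (M + 1) => n.
pose N := (Num.truncn `|x i n| + Num.truncn `|y i n|).+1.
have [m Nm mn] := ruler_large n N.
have hx : `|x i n| <= m%:R.
  apply: ltW; apply: lt_le_trans (truncnS_gt _) _; rewrite ler_nat.
  by rewrite (leq_trans _ Nm)// ltnS leq_addr.
have hy : `|y i n| <= m%:R.
  apply: ltW; apply: lt_le_trans (truncnS_gt _) _; rewrite ler_nat.
  by rewrite (leq_trans _ Nm)// ltnS leq_addl.
apply: (le_trans (digit_exact hx hy)); rewrite lerD2r.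
have := hM m; rewrite !dE mn -mulrBr normrM ger0_norm// => h.
by apply: le_trans h; rewrite ler_peMl// ler1n.
Qed.

End Coding.

Theorem mainTheorem8 (R : realType) :
  exists X : metricType R,
    continuum [set: X] /\
    @borel_bireducible X (real_seq_seq R)
      (@chain_continuum_connected R X)
      (@rel_power (real_seq R) (@eq_mod_linfty R)).
Proof.
exists (fold_space R); split; first exact: fold_continuum.
split.
- exists (@sval _ _); split; first exact: fold_val_borel.
  exact: fold_chainP.
- exists (@encode R); split; first exact: encode_borel.
  move=> x y; apply: (iff_trans (encodeP x y)); apply: iff_sym.
  exact: fold_chainP.
Qed.
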